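(* Let $\mathcal V$ be a set of $N$ elements, $\textsc{d}$ a symmetric real-valued function on pairs of distinct elements of $\mathcal V$ computable in time $O(1)$, and $\kappa>0$. Assume that $\textsc{FindKNN}(k,\mathcal U,\textsc{d})$ completes in time $O(k^2|\mathcal U|\log|\mathcal U|)$ for every node set $\mathcal U$. Then $\textsc{FindBest}(\kappa N,\mathcal V,\textsc{d})$ completes in time $O(\kappa^{3/2}N^{3/2}\log N)$.
   Context: $\textsc{FindKNN}(k,\mathcal U,\textsc{d})$ is the NNDescent procedure: start with a directed graph $\bm G$ on $\mathcal U$ in which each node has $k$ out-neighbors chosen uniformly at random; repeatedly, for every node $i$, for every neighbor $j$ of $i$ and every neighbor $v\ne i$ of $j$ in the undirected version of $\bm G$ with $(i,v)$ not already an out-edge of $i$, replace the out-edge $(i,\hat u)$ of $i$ with largest $\textsc{d}(i,\hat u)$ by $(i,v)$ whenever $\textsc{d}(i,v)<\textsc{d}(i,\hat u)$; stop when the fraction of replacements per $k|\mathcal U|$ falls below a threshold; return $\bm G$ (each node has out-degree $k$). $\textsc{FindBest}(m,\mathcal S,\textsc{d})$: if $|\mathcal S|^2\le 4m$, return the $m$ pairs of elements of $\mathcal S$ with smallest $\textsc{d}$ found by exhaustive search. Otherwise set $k=\lceil 4m/|\mathcal S|\rceil$, $\bm G=\textsc{FindKNN}(k,\mathcal S,\textsc{d})$; let $\mathcal D^+$ be the $2m$ directed edges $(i,j)$ of $\bm G$ with smallest $\textsc{d}(i,j)$, $\mathcal D$ the set of distinct undirected pairs occurring in $\mathcal D^+$,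 and $\mathcal S'=\{i\in\mathcal S:\{i,j\}\in\mathcal D\text{ for every out-neighbor } j \text{ of } i \text{ in } \bm G\}$; compute $\mathcal D'=\textsc{FindBest}(m,\mathcal S',\textsc{d})$ recursively and return the $m$ pairs in $\mathcal D\cup\mathcal D'$ with smallest $\textsc{d}$. *)

(* Defs.v *)
From HB Require Import structures.
From mathcomp Require Import all_boot all_order all_algebra.
From mathcomp Require Import all_classical all_reals all_analysis.

Set Implicit Arguments.
Unset Strict Implicit.
Unset Printing Implicit Defensive.

Import Order.TTheory GRing.Theory Num.Theory.

Local Open Scope ring_scope.

(* A randomized program, as the tree of all its executions.  [Tick n p] spends
   [n] units of time and continues as [p]; [Unif s f] draws [x] uniformly from
   [s] and continues as [f x].  Unbounded loops and recursions are unrolled up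
   to a given depth (the "fuel"), below which the tree is cut with [Stuck]. *)
Inductive prog (A : Type) : Type :=
| Ret of A
| Tick of nat & prog A
| Unif (T : finType) of {set T} & (T -> prog A)
| Stuck.

Arguments Stuck {A}.

Fixpoint bind (A B : Type) (p : prog A) (f : A -> prog B) : prog B :=
  match p with
  | Ret a => f a
  | Tick n q => Tick n (bind q f)
  | Unif T s g => Unif s (fun x => bind (g x) f)
  | Stuck => Stuck
  end.

Notation "x <-- p ;; q" := (bind p (fun x => q))
  (at level 60, p at next level, right associativity).

Fixpoint foldM (A X : Type) (f : A -> X -> prog A) (a : A) (s : seq X) :
    prog A :=
  if s is x :: s' then b <-- f a x ;; foldM f b s' else Ret a.

(* No execution is cut and no draw is made from an empty set: the tree is then
   the complete one, and a larger fuel does not change it. *)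
Fixpoint total (A : Type) (p : prog A) : Prop :=
  match p with
  | Ret _ => True
  | Tick _ q => total q
  | Unif T s f => s != finset.set0 /\ forall x, x \in s -> total (f x)
  | Stuck => False
  end.

Fixpoint expected_time (R : realType) (A : Type) (p : prog A) : R :=
  match p with
  | Ret _ => 0
  | Tick n q => n%:R + expected_time R q
  | Unif T s f => (\sum_(x in s) expected_time R (f x)) / #|s|%:R
  | Stuck => 0
  end.

(* The running time of a randomized procedure is its expected running time.
   Worst-case time would be inadequate for nearest neighbor descent: a random
   initial graph may be a star, on which one pass alone is quadratic. *)
Definition completes_within (R : realType) (A : Type) (p : nat -> prog A)
    (b : R) : Prop :=
  exists fuel, total (p fuel) /\ expected_time R (p fuel) <= b.

Section Algorithms.

(* [tau x y] is the time taken by one evaluation of [d x y].  The other unit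
   costs are those of standard data structures: hash tables with O(1) access
   for adjacency and for sets of pairs, one priority queue per node (keyed by
   [d], with stored keys) for its out-neighbors, and comparison sorting. *)
Variables (R : realType) (V : finType) (d : V -> V -> R) (tau : V -> V -> nat).

(* A directed graph, given by its sets of out-neighbors. *)
Definition digraph := {ffun V -> {set V}}.

(* Every node of [U] has [k] out-neighbors, or all the other nodes of [U] when
   there are fewer than [k] of them.  A uniform element of this set amounts to
   independent uniform choices of out-neighbors for the nodes of [U]. *)
Definition init_graphs (k : nat) (U : {set V}) : {set digraph} :=
  [set G : digraph | [forall i,
     if i \in U then (G i \subset U :\ i) && (#|G i| == minn k #|U|.-1)
     else G i == finset.set0]].

Definition pq_cost (n : nat) : nat := (trunc_log 2 n).+1.

Definition undirected_nbrs (G : digraph) (U : {set V}) (i : V) : seq V :=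
  [seq j <- enum U | (j \in G i) || (i \in G j)].

Definition farthest (G : digraph) (i : V) : option V :=
  [pick u in G i | [forall w in G i, d i w <= d i u]].

Definition replace_edge (G : digraph) (i u v : V) : digraph :=
  [ffun x => if x == i then v |: (G i :\ u) else G x].

(* The natural number in the state counts the replacements of the pass. *)
Definition try_edge (i : V) (st : digraph * nat) (v : V) :
    prog (digraph * nat) :=
  let: (G, r) := st in
  Tick 1
    (if (v != i) && (v \notin G i) then
       Tick (tau i v).+1
         (if farthest G i is Some u then
            if d i v < d i u then
              Tick (pq_cost #|G i|) (Ret (replace_edge G i u v, r.+1))
            else Ret st
          else Ret st)
     else Ret st).

(* [G0] is the graph at the start of the pass: its undirected version is built
   once per pass, while out-edges are replaced in place. *)
Definition knn_pass (U : {set V}) (G0 : digraph) : prog (digraph * nat) :=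
  Tick (#|U| + \sum_(i in U) #|G0 i|)
    (foldM (fun st i => Tick 1
       (foldM (fun st j => Tick 1
          (foldM (try_edge i) st (undirected_nbrs G0 U j)))
        st (undirected_nbrs G0 U i)))
     (G0, 0%N) (enum U)).

(* The stopping threshold on the fraction of replacements. *)
Variable delta : R.

Fixpoint knn_loop (fuel k : nat) (U : {set V}) (G : digraph) : prog digraph :=
  if fuel is fuel'.+1 then
    st <-- knn_pass U G ;;
    if st.2%:R / (k * #|U|)%:R < delta then Ret st.1
    else knn_loop fuel' k U st.1
  else Stuck.

Definition find_knn (fuel k : nat) (U : {set V}) : prog digraph :=
  Unif (init_graphs k U) (fun G =>
    Tick (#|U| + \sum_(i in U) \sum_(u in G i) (tau i u + pq_cost #|G i|))
      (knn_loop fuel k U G)).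

(* Unordered pairs of distinct nodes are represented by their increasing
   enumeration. *)
Definition upair (e : V * V) : V * V :=
  if (enum_rank e.1 <= enum_rank e.2)%N then e else (e.2, e.1).

(* Ties of [d] are broken by a fixed total order on unordered pairs, so that
   the two orientations of a pair are always consecutive.  Under an arbitrary
   tie-breaking rule the [2m] shortest directed edges could be one orientation
   of every edge of a symmetric graph, and [find_best] would recurse on the
   same node set forever. *)
Definition edge_le (e f : V * V) : bool :=
  let: (a, b) := upair e in
  let: (x, y) := upair f in
  (d e.1 e.2 < d f.1 f.2) ||
  (d e.1 e.2 == d f.1 f.2) &&
    ((enum_rank a < enum_rank x)%N ||
     (a == x) && (enum_rank b <= enum_rank y)%N).

Definition smallest (m : nat) (s : seq (V * V)) : prog (seq (V * V)) :=
  Tick (\sum_(e <- s) tau e.1 e.2 + size s * (trunc_log 2 (size s)).+1)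
    (Ret (take m (sort edge_le s))).

Definition pairs_of (S : {set V}) : seq (V * V) :=
  [seq e <- [seq (i, j) | i <- enum S, j <- enum S]
     | (enum_rank e.1 < enum_rank e.2)%N].

Definition edges_of (G : digraph) (S : {set V}) : seq (V * V) :=
  [seq (i, j) | i <- enum S, j <- enum (G i)].

Definition ceil_div (a b : nat) : nat := (a + b.-1) %/ b.

Fixpoint find_best (fuel m : nat) (S : {set V}) : prog (seq (V * V)) :=
  if fuel is fuel'.+1 then
    if (#|S| ^ 2 <= 4 * m)%N then
      Tick (#|S| ^ 2).+1 (smallest m (pairs_of S))
    else
      let k := ceil_div (4 * m) #|S| in
      G <-- find_knn fuel' k S ;;
      Dplus <-- Tick (size (edges_of G S)).+1
                  (smallest (2 * m) (edges_of G S)) ;;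
      let D := undup [seq upair e | e <- Dplus] in
      let S' := [set i in S | [forall j in G i, upair (i, j) \in D]] in
      D' <-- Tick (size Dplus + \sum_(i in S) #|G i|.+1)
               (find_best fuel' m S') ;;
      Tick (size D + size D') (smallest m (undup (D ++ D')))
  else Stuck.

End Algorithms.

(* Main.v *)
(* Write n = |S|.  The sorted list of directed edges keeps the two orientations
   of a pair adjacent, so at most 2m+1 edges of G have their pair in D.  Every
   node of S' contributes min(k, n-1) such edges, with k >= 4m/n, hence
   |S'| <= 3n/4.  One level of the recursion costs O(k^2 n log N), and
   k^2 n <= 32 m^2/n + 2n; as n decreases geometrically and stays above
   2 sqrt m, the terms m^2/n are dominated by the last one, O(m^(3/2)), and the
   terms 2n add up to at most 8N, which is below 8 m^(3/2) once N >= 1/kappa0^3. *)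

Require Import Defs.
From mathcomp Require Import all_boot all_order all_algebra.
From mathcomp Require Import all_classical all_reals all_analysis.
From mathcomp Require Import zify ring lra.
Import Defs.
Import Order.TTheory GRing.Theory Num.Theory.
Local Open Scope ring_scope.

Set Implicit Arguments.
Unset Strict Implicit.
Unset Printing Implicit Defensive.

(** * Postconditions and expected time of randomized programs *)

(* Partial correctness: nothing is claimed of a cut execution. *)
Fixpoint post (A : Type) (Q : A -> Prop) (p : prog A) : Prop :=
  match p with
  | Ret a => Q a
  | Tick _ q => post Q q
  | Unif T s f => forall x, x \in s -> post Q (f x)
  | Stuck => True
  end.

Lemma post_sub (A : Type) (P Q : A -> Prop) (p : prog A) :
  (forall a, P a -> Q a) -> post P p -> post Q p.
Proof.
move=> PQ; elim: p => //= T s f IH Pf x xs.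
exact/IH/Pf.
Qed.

Lemma postT (A : Type) (p : prog A) : post (fun=> True) p.
Proof. by elim: p => //= T s f IH x _; apply: IH. Qed.

Lemma post_bind (A B : Type) (Q : B -> Prop) (p : prog A) (f : A -> prog B) :
  post (fun a => post Q (f a)) p -> post Q (bind p f).
Proof. by elim: p => //= T s g IH Qg x xs; apply/IH/Qg. Qed.

Lemma post_foldM (A X : Type) (Q : A -> Prop) (f : A -> X -> prog A) a s :
  (forall a x, Q a -> post Q (f a x)) -> Q a -> post Q (foldM f a s).
Proof.
move=> Qf; elim: s a => //= x s IH a Qa.
by apply/post_bind/post_sub/Qf/Qa.
Qed.

Lemma total_bind (A B : Type) (p : prog A) (f : A -> prog B) :
  total p -> post (fun a => total (f a)) p -> total (bind p f).
Proof.
elim: p => //= T s g IH [s0 tg] Qg; split=> // x xs.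
by apply: IH; [exact: tg|exact: Qg].
Qed.

(** Totality makes every set drawn from nonempty, so averaging the constant [b] gives back [b]. It
    also excludes cut branches, where the bound would need [b] nonnegative. *)
Lemma expected_time_bind_le (R : realType) (A B : Type) (p : prog A)
    (f : A -> prog B) (a b : R) :
  total p -> expected_time R p <= a ->
  post (fun x => expected_time R (f x) <= b) p ->
  expected_time R (bind p f) <= a + b.
Proof.
move=> tp pa fb; apply: (@le_trans _ _ (expected_time R p + b)); last first.
  by rewrite lerD2r.
elim: p tp fb {pa} => //= [x _ fb|n q IH tq fb|T s g IH [s0 tg] fb].
- by rewrite add0r.
- by rewrite -addrA lerD2l IH.
have cs : 0 < #|s|%:R :> R by rewrite ltr0n card_gt0.
rewrite ler_pdivrMr // mulrDl divfK ?gt_eqF // mulr_natr -sumr_const.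
by rewrite -big_split ler_sum // => x xs; apply: IH; [exact: tg|exact: fb].
Qed.

(** Serves to compare fuels: [f] and [g] are the rest of a run at two successive fuels. *)
Lemma total_bind_mono (R : realType) (A B : Type) (p : prog A)
    (f g : A -> prog B) :
  (forall a, total (f a) ->
     total (g a) /\ expected_time R (g a) = expected_time R (f a)) ->
  total (bind p f) ->
  total (bind p g) /\
  expected_time R (bind p g) = expected_time R (bind p f).
Proof.
move=> fg; elim: p => //= [n q IH|T s h IH].
- by move=> /IH[? ->].
move=> [s0 th]; split; first by split=> // x xs; have [] := IH x (th x xs).
by congr (_ / _); apply: eq_bigr => x xs; have [] := IH x (th x xs).
Qed.

(** * Nearest neighbor descent: fuel and out-degrees *)

Section NearestNeighborDescent.
Variables (R : realType) (V : finType) (d : V -> V -> R) (tau : V -> V -> nat).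
Variable delta : R.

Definition out_regular (U : {set V}) (q : nat) (G : digraph V) : Prop :=
  forall i, i \in U -> #|G i| = q.

Lemma knn_loop_fuelS fuel k U G :
  total (knn_loop d tau delta fuel k U G) ->
  total (knn_loop d tau delta fuel.+1 k U G) /\
  expected_time R (knn_loop d tau delta fuel.+1 k U G) =
  expected_time R (knn_loop d tau delta fuel k U G).
Proof.
elim: fuel G => // fuel IH G.
rewrite {1}/knn_loop -/knn_loop => tG.
rewrite -[knn_loop d tau delta fuel.+2 k U G]/(bind _ _).
apply: total_bind_mono tG => st; case: ifP => // _.
exact: IH.
Qed.

Lemma find_knn_fuel_mono f1 f2 k U : (f1 <= f2)%N ->
  total (find_knn d tau delta f1 k U) ->
  total (find_knn d tau delta f2 k U) /\
  expected_time R (find_knn d tau delta f2 k U) =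
  expected_time R (find_knn d tau delta f1 k U).
Proof.
move=> /subnK <-; elim: (f2 - f1)%N => // n IH /IH[[s0 tn] <-] {IH}.
rewrite addSn; split.
  by split=> // G /tn tG; have [] := knn_loop_fuelS tG.
rewrite /=; congr (_ / _); apply: eq_bigr => G /tn tG.
by congr (_ + _); have [] := knn_loop_fuelS tG.
Qed.

(** A replacement drops an element of [G i], since [farthest] picks inside it, and adds a node
    outside [G i], so out-degrees are invariant. *)
Lemma post_try_edge U q i st v :
  out_regular U q st.1 ->
  post (fun st => out_regular U q st.1) (try_edge d tau i st v).
Proof.
case: st => G r /= Gq; case: ifP => //= /andP[_ vG].
rewrite /farthest; case: pickP => //= u /andP[uG _].
case: ifP => //= _ x xU; rewrite /= ffunE; case: eqP => [xi|_]; last exact: Gq.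
subst x; rewrite cardsU1 !inE (negPf vG) andbF /= -(Gq i xU).
by rewrite (cardsD1 u (G i)) uG.
Qed.

Lemma post_knn_pass U q G :
  out_regular U q G ->
  post (fun st => out_regular U q st.1) (knn_pass d tau U G).
Proof.
move=> Gq /=; apply: post_foldM => // st i st_q /=.
apply: post_foldM => // {st_q} st' j st'_q /=.
by apply: post_foldM => // st'' v; apply: post_try_edge.
Qed.

Lemma post_find_knn fuel k U :
  post (out_regular U (minn k #|U|.-1)) (find_knn d tau delta fuel k U).
Proof.
move=> G; rewrite inE => /forallP G_init /=.
have : out_regular U (minn k #|U|.-1) G.
  by move=> i iU; have := G_init i; rewrite iU => /andP[_ /eqP].
elim: fuel G {G_init} => //= fuel IH G Gq.
apply/post_bind/post_sub/post_knn_pass/Gq => st st_q.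
by case: ifP => // _; apply: IH.
Qed.

End NearestNeighborDescent.

(** * Rounded-up division *)

Lemma leq_ceil_div_mul a b : (0 < b)%N -> (a <= ceil_div a b * b)%N.
Proof.
move=> b0; rewrite /ceil_div; have := divn_eq (a + b.-1) b.
have : ((a + b.-1) %% b < b)%N by rewrite ltn_pmod.
by move: (_ %/ _)%N (_ %% _)%N => q r; lia.
Qed.

Lemma ceil_div_mul_leq a b : (0 < b)%N -> (ceil_div a b * b <= a + b)%N.
Proof.
move=> b0; rewrite (leq_trans (leq_divM _ _)) // leq_add2l.
exact: leq_pred.
Qed.

(** * Sorted edges and the nodes kept for the recursion *)

Section ShortestEdges.
Variables (R : realType) (V : finType) (d : V -> V -> R).

Lemma upair_eq (e f : V * V) : upair e = upair f -> f = e \/ f = (e.2, e.1).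
Proof.
case: e f => [a b] [x y]; rewrite /upair /=.
by case: ifP => _; case: ifP => _ [-> ->]; [left|right|right|left].
Qed.

Lemma edge_leE (e f : V * V) :
  edge_le d e f =
  (d e.1 e.2 < d f.1 f.2) ||
  (d e.1 e.2 == d f.1 f.2) &&
    ((enum_rank (upair e).1 < enum_rank (upair f).1)%N ||
     ((upair e).1 == (upair f).1) &&
       (enum_rank (upair e).2 <= enum_rank (upair f).2)%N).
Proof. by rewrite /edge_le; case: (upair e) => a b; case: (upair f). Qed.

Lemma edge_le_total : ssrbool.total (edge_le d).
Proof.
move=> e f; rewrite !edge_leE; case: ltgtP => //= _.
rewrite [X in _ || (_ || X && _)]eq_sym -(inj_eq enum_rank_inj) -val_eqE /=.
by case: ltngtP => //= _; apply: leq_total.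
Qed.

Lemma edge_le_trans : transitive (edge_le d).
Proof.
move=> f e g; rewrite !edge_leE.
rewrite -!(inj_eq (@enum_rank_inj V)) -!val_eqE /=.
move: (enum_rank _ : nat) (enum_rank _ : nat) (enum_rank _ : nat) => f1 e1 f2.
move: (enum_rank _ : nat) (enum_rank _ : nat) (enum_rank _ : nat) => e2 g1 g2.
move=> /orP[ef|/andP[/eqP-> ef]] /orP[fg|/andP[/eqP<- fg]].
- by rewrite (lt_trans ef fg).
- by rewrite ef.
- by rewrite fg.
- by rewrite eqxx ltxx /=; lia.
Qed.

(** Ties of [d] are settled on the unordered pair alone, so antisymmetry holds up to orientation. *)
Lemma edge_le_anti (e f : V * V) :
  edge_le d e f -> edge_le d f e -> upair e = upair f.
Proof.
rewrite !edge_leE => ef fe.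
suff [/val_inj/enum_rank_inj e1 /val_inj/enum_rank_inj e2] :
    (enum_rank (upair e).1 = enum_rank (upair f).1 :> nat) /\
    (enum_rank (upair e).2 = enum_rank (upair f).2 :> nat).
  by move: e1 e2; case: (upair e) => ? ?; case: (upair f) => ? ? /= -> ->.
move: ef fe; rewrite -!(inj_eq (@enum_rank_inj V)) -!val_eqE /=.
by case: ltgtP => //= _; lia.
Qed.

Hypothesis d_sym : forall x y, x != y -> d x y = d y x.

Lemma edge_le_upair (e f : V * V) : upair e = upair f -> edge_le d e f.
Proof.
move=> ef; rewrite edge_leE -ef eqxx ltnn leqnn /= andbT.
suff -> : d f.1 f.2 = d e.1 e.2 by rewrite eqxx orbT.
(* Symmetry is assumed for distinct nodes; a loop is its own reversal. *)
case: (upair_eq ef) => -> //=; have [->//|] := eqVneq e.1 e.2.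
by move=> /d_sym ->.
Qed.

(* Between two edges with the same unordered pair, the sorted list contains
   only edges with that pair, and there are at most two of these. *)
Lemma mem_take_upair (q : nat) (s : seq (V * V)) (e : V * V) :
  uniq s -> e \in s ->
  upair e \in [seq upair f | f <- take q (sort (edge_le d) s)] ->
  e \in take q.+1 (sort (edge_le d) s).
Proof.
move=> us; rewrite -(mem_sort (edge_le d)).
have := sort_sorted edge_le_total s.
move: us; rewrite -(sort_uniq (edge_le d)).
move: (sort _ s) => t ut st et /mapP[f fq ef].
have [i [iq it fi]] : exists i, [/\ (i < q)%N, (i < size t)%N & f = nth e t i].
  exists (index f (take q t)); have := fq; rewrite -index_mem size_take_min.
  by rewrite leq_min => /andP[iq it]; split=> //; rewrite -(nth_take _ iq) nth_index.
have jt : (index e t < size t)%N by rewrite index_mem.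
have ej : nth e t (index e t) = e by rewrite nth_index.
have [jq|qj] := ltnP (index e t) q.+1.
  by rewrite -{1}ej -(nth_take _ jq) mem_nth // size_take_min leq_min jq.
have qt : (q < size t)%N by exact: ltn_trans qj jt.
have [reflE tr] : (reflexive (edge_le d)) /\ transitive (edge_le d).
  by split; [move=> x; apply: edge_le_upair|apply: edge_le_trans].
have le_nth := sorted_leq_nth tr reflE e st.
(* With [e] beyond position [q], the entry at [q] is squeezed between [f] and [e] and must carry the
   same pair. *)
have fg : edge_le d f (nth e t q) by rewrite fi le_nth // ?inE // ltnW.
have ge : edge_le d (nth e t q) e by rewrite -{2}ej le_nth // ?inE // ltnW.
have gf : upair (nth e t q) = upair f.
  apply: edge_le_anti => //; apply: tr ge _; exact: edge_le_upair.
have nth_inj a b :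
    (a < size t)%N -> (b < size t)%N -> nth e t a = nth e t b -> a = b.
  by move=> ha hb /eqP; rewrite nth_uniq // => /eqP.
have fe : f <> e by rewrite -ej fi => /nth_inj -/(_ it jt); lia.
have gne : nth e t q <> e by rewrite -{2}ej => /nth_inj -/(_ qt jt); lia.
have gnf : nth e t q <> f by rewrite fi => /nth_inj -/(_ qt it); lia.
(* Both [f] and the entry at [q] differ from [e], so each is the reversal of [e], and they
   coincide. *)
have [//|f_eq] := upair_eq ef; have [//|g_eq] := upair_eq (etrans ef (esym gf)).
by case: gnf; rewrite g_eq f_eq.
Qed.

Lemma mem_edges_of (G : digraph V) (S : {set V}) (e : V * V) :
  (e \in edges_of G S) = (e.1 \in S) && (e.2 \in G e.1).
Proof.
apply/allpairsPdep/andP => [[x [y [xS yG ->]]]|[e1 e2]].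
  by move: xS yG; rewrite !mem_enum.
by exists e.1, e.2; rewrite !mem_enum; split=> //; case: e {e1 e2}.
Qed.

Lemma edges_of_uniq (G : digraph V) (S : {set V}) : uniq (edges_of G S).
Proof.
apply: allpairs_uniq_dep => [|x _|]; rewrite ?enum_uniq //.
by move=> [x1 y1] [x2 y2] _ _ /= [-> ->].
Qed.

Lemma size_edges_of (G : digraph V) (S : {set V}) :
  size (edges_of G S) = (\sum_(i in S) #|G i|)%N.
Proof.
rewrite size_allpairs_dep sumnE big_map big_enum /=.
by apply: eq_bigr => i _; rewrite -cardE.
Qed.

Lemma size_edges_of_regular (G : digraph V) (S : {set V}) q :
  out_regular S q G -> size (edges_of G S) = (#|S| * q)%N.
Proof.
move=> Gq; rewrite size_edges_of -sum_nat_const.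
by apply: eq_bigr => i; apply: Gq.
Qed.

(* The node set S' of the recursive call. *)
Definition saturated (m : nat) (G : digraph V) (S : {set V}) : {set V} :=
  [set i in S | [forall j in G i, upair (i, j) \in
     undup [seq upair e | e <- take (2 * m) (sort (edge_le d) (edges_of G S))]]].

Lemma saturated_sub m G S : saturated m G S \subset S.
Proof. by apply/fintype.subsetP => i; rewrite inE => /andP[]. Qed.

(** All edges leaving the kept nodes lie in the prefix of length [2 * m + 1]. The extra edge is
    there because cutting at [2 * m] may separate the two orientations of one pair. *)
Lemma card_saturated m G (S : {set V}) q : out_regular S q G ->
  (#|saturated m G S| * q <= (2 * m).+1)%N.
Proof.
move=> Gq; rewrite -(@size_edges_of_regular G); last first.
  by move=> i /(fintype.subsetP (saturated_sub m G S)); apply: Gq.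
set t := take (2 * m).+1 (sort (edge_le d) (edges_of G S)).
apply: (@leq_trans (size t)); last by rewrite size_take_min geq_minl.
apply: uniq_leq_size => [|e]; first exact: edges_of_uniq.
rewrite mem_edges_of inE => /andP[/andP[e1 /forall_inP He] e2].
apply: mem_take_upair; first exact: edges_of_uniq.
  by rewrite mem_edges_of e1.
by move/He: e2; rewrite mem_undup; case: (e).
Qed.

Lemma card_saturated_le m G (S : {set V}) :
  (0 < m)%N -> (4 * m < #|S| ^ 2)%N ->
  out_regular S (minn (ceil_div (4 * m) #|S|) #|S|.-1) G ->
  (4 * #|saturated m G S| <= 3 * #|S|)%N.
Proof.
move=> m0 mS /card_saturated -/(_ m).
have S_gt0 : (0 < #|S|)%N by rewrite -(@ltn_exp2r _ _ 2) // (leq_ltn_trans _ mS).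
have := leq_ceil_div_mul (4 * m) S_gt0; move: (ceil_div _ _) => k kS.
move: mS kS {S_gt0}; move: #|S| #|saturated m G S| => n s.
rewrite -mulnn => mn kn; rewrite /minn; case: ifP => _ H.
  (* Degree [k]: [4 m s <= k n s <= n (2 m + 1) <= 3 m n]. *)
  rewrite -(leq_pmul2l m0).
  have : (4 * m * s <= n * (2 * m).+1)%N.
    apply: leq_trans (leq_mul kn (leqnn s)) _.
    by rewrite -mulnA mulnC -mulnA leq_mul2l H orbT.
  have : (n <= n * m)%N by rewrite leq_pmulr.
  by lia.
(* Degree [n - 1]: [s > 3 n / 4] would give [(3 n + 1) (n - 1) <= 8 m + 4 <= 2 n^2 + 2], impossible
   from [n = 4] on. Smaller [n] are checked one by one. *)
have [n4|] := leqP 4 n; last first.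
  by case: n mn kn H => [|[|[|[|//]]]]; lia.
rewrite leqNgt; apply/negP => sn.
have : ((3 * n).+1 * n.-1 <= 4 * s * n.-1)%N by rewrite leq_mul2r sn orbT.
have : (4 * n <= n * n)%N by rewrite leq_mul2r n4 orbT.
by case: n {kn sn} n4 mn H => // n; rewrite succnK; lia.
Qed.

End ShortestEdges.

(** * A potential function for the recursion *)

Section Potential.
Variables (R : realType) (m : nat).
Let s : R := Num.sqrt m%:R.

(* The subtracted term makes the recursion telescope: it grows by at least
   128/3 m^2/n when n shrinks to 3n/4, which pays for the 32 m^2/n of a level. *)
Definition potential (n : nat) : R :=
  if (n ^ 2 <= 4 * m)%N then s ^+ 3
  else 81 * s ^+ 3 + 8 * n%:R - 128 * (m%:R ^+ 2 / n%:R).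

Let sm : s ^+ 2 = m%:R.
Proof. by rewrite sqr_sqrtr. Qed.

Let sm4 : m%:R ^+ 2 = s ^+ 3 * s.
Proof. by rewrite -sm; ring. Qed.

Lemma potential_step n n' k :
  (4 * m < n ^ 2)%N -> (4 * n' <= 3 * n)%N -> (k * n <= 4 * m + n)%N ->
  potential n' + k%:R ^+ 2 * n%:R <= potential n.
Proof.
move=> mn n'n kn; have n_gt0 : 0 < n%:R :> R by rewrite ltr0n; case: n mn {n'n kn}.
have s0 : 0 <= s by rewrite sqrtr_ge0.
have sn : 2 * s <= n%:R.
  rewrite -(@ler_pXn2r _ 2) ?nnegrE ?mulr_ge0 // exprMn sm -!natrX -natrM.
  by rewrite ler_nat ltnW.
set x : R := m%:R ^+ 2 / n%:R.
(* From [k n <= 4 m + n] and [(a + b)^2 <= 2 a^2 + 2 b^2], after division by [n]. *)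
have level_le : k%:R ^+ 2 * n%:R <= 32 * x + 2 * n%:R.
  have {}kn : k%:R * n%:R <= 4 * m%:R + n%:R :> R by rewrite -!natrM -natrD ler_nat.
  rewrite -(ler_pM2r n_gt0) [X in _ <= X]mulrDl /x mulrA divfK ?gt_eqF //.
  apply: (@le_trans _ _ ((4 * m%:R + n%:R) ^+ 2)).
    have -> : k%:R ^+ 2 * n%:R * n%:R = (k%:R * n%:R) ^+ 2 :> R by ring.
    by rewrite ler_pXn2r ?nnegrE ?addr_ge0 ?mulr_ge0.
  by have := sqr_ge0 (4 * m%:R - n%:R : R); nra.
(* Since [n >= 2 s], [x = s^4 / n] is at most [s^3 / 2]. *)
have xs : 2 * x <= s ^+ 3.
  rewrite /x mulrA ler_pdivrMr // sm4 mulrCA.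
  by rewrite ler_wpM2l // exprn_ge0.
rewrite {2}/potential leqNgt mn /= -/x.
rewrite /potential; case: ifPn => [_|].
  (* The recursion ends here: [160 x <= 80 s^3] is needed besides the base value [s^3], whence the
     coefficient 81. *)
  by have := ltW n_gt0; lra.
rewrite -ltnNge => mn'.
have n'_gt0 : 0 < n'%:R :> R by rewrite ltr0n; case: n' mn' {n'n}.
have {}n'n : 4 * n'%:R <= 3 * n%:R :> R by rewrite -!natrM ler_nat.
have xx' : 4 * x <= 3 * (m%:R ^+ 2 / n'%:R).
  have -> : 4 * x = 4 * n'%:R * (m%:R ^+ 2 / (n'%:R * n%:R)).
    by rewrite /x; field; rewrite !gt_eqF.
  have -> : 3 * (m%:R ^+ 2 / n'%:R) = 3 * n%:R * (m%:R ^+ 2 / (n'%:R * n%:R)) :> R.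
    by field; rewrite !gt_eqF.
  by rewrite ler_wpM2r // divr_ge0 ?exprn_ge0 ?mulr_ge0.
have x0 : 0 <= x by rewrite divr_ge0 ?exprn_ge0.
(* The linear terms balance, [8 n' + 2 n <= 8 n], and [128 (x' - x) >= 128 x / 3] covers [32 x],
   where [x'] is [m^2 / n']. *)
lra.
Qed.

Lemma potential_le n : potential n <= 81 * s ^+ 3 + 8 * n%:R.
Proof.
have s0 : 0 <= s ^+ 3 by rewrite exprn_ge0 ?sqrtr_ge0.
have n0 : 0 <= n%:R :> R by [].
rewrite /potential; case: ifP => _; first by lra.
by rewrite gerBl mulr_ge0 ?divr_ge0 ?exprn_ge0.
Qed.

(** As [s >= 1], [s^2 <= s^3]: the base value absorbs the exhaustive search, whose cost is
    proportional to [m]. *)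
Lemma natr_le_potential n : (0 < m)%N -> (n ^ 2 <= 4 * m)%N ->
  m%:R <= potential n.
Proof.
move=> m0 nm; rewrite /potential nm -sm ler_weXn2l //.
by rewrite -(@ler_pXn2r _ 2) ?nnegrE ?sqrtr_ge0 // sm expr1n ler1n.
Qed.

End Potential.

(** * Expected time of the recursive search *)

Section FindBestTime.
Variables (R : realType) (V : finType) (d : V -> V -> R) (tau : V -> V -> nat).
Variables (delta : R) (c L m : nat).
Hypothesis d_sym : forall x y, x != y -> d x y = d y x.
Hypothesis tau_le : forall x y, (tau x y <= c)%N.
Hypothesis log_lt : (trunc_log 2 (#|V| ^ 2) < L)%N.
Hypothesis m_gt0 : (0 < m)%N.

Lemma selection_time (s : seq (V * V)) : (size s <= #|V| ^ 2)%N ->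
  (\sum_(e <- s) tau e.1 e.2 + size s * (trunc_log 2 (size s)).+1 <=
   (c + L) * size s)%N.
Proof.
move=> sV; rewrite mulnDl leq_add //; last first.
  by rewrite mulnC leq_mul2r (leq_ltn_trans (leq_trunc_log _ sV)) ?orbT.
rewrite mulnC -sum1_size big_distrl /=; apply: leq_sum => e _.
by rewrite mul1n.
Qed.

Definition selected (G : digraph V) (S : {set V}) : seq (V * V) :=
  take (2 * m) (sort (edge_le d) (edges_of G S)).

(** One level of [find_best] after the descent, with the deterministic binds already reduced, so
    that the recursive call is the only bind left. *)
Definition after_knn fuel (S : {set V}) (G : digraph V) : prog (seq (V * V)) :=
  Tick (size (edges_of G S)).+1
    (Tick (\sum_(e <- edges_of G S) tau e.1 e.2 +
           size (edges_of G S) * (trunc_log 2 (size (edges_of G S))).+1)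
      (Tick (size (selected G S) + \sum_(i in S) #|G i|.+1)
        (D' <-- find_best d tau delta fuel m (saturated d m G S) ;;
         let D := undup [seq upair e | e <- selected G S] in
         Tick (size D + size D') (smallest d tau m (undup (D ++ D')))))).

Lemma find_best_recE fuel (S : {set V}) : (4 * m < #|S| ^ 2)%N ->
  find_best d tau delta fuel.+1 m S =
  G <-- find_knn d tau delta fuel (ceil_div (4 * m) #|S|) S ;;
  after_knn fuel S G.
Proof. by rewrite /find_best ltnNge => /negbTE ->. Qed.

(** Needed for the final merge, which then handles at most [2 * m + m] pairs. *)
Lemma post_find_best fuel S :
  post (fun D => (size D <= m)%N) (find_best d tau delta fuel m S).
Proof.
have size_smallest (s : seq (V * V)) : (size (take m s) <= m)%N.
  by rewrite size_take_min geq_minl.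
case: fuel => // fuel; have [Sm|mS] := leqP (#|S| ^ 2) (4 * m).
  by rewrite /= Sm /=.
rewrite find_best_recE //.
apply/post_bind/(@post_sub _ (fun=> True)); last exact: postT.
move=> G _ /=; apply/post_bind/(@post_sub _ (fun=> True)); last exact: postT.
by move=> D' _ /=.
Qed.

(** At most [4 * m] pairs are listed, each at cost [c + L] up to constants. The 12 is generous, so
    that the same factor serves the recursive levels. *)
Lemma find_best_base_time fuel (S : {set V}) : (#|S| ^ 2 <= 4 * m)%N ->
  total (find_best d tau delta fuel.+1 m S) /\
  expected_time R (find_best d tau delta fuel.+1 m S) <=
    ((4 * c + 12) * L * m)%:R.
Proof.
move=> Sm; rewrite /= Sm /=; split=> //; rewrite addr0 -natrD ler_nat.
have size_pairs : (size (pairs_of S) <= #|S| ^ 2)%N.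
  by rewrite size_filter (leq_trans (count_size _ _)) // size_allpairs -cardE mulnn.
have SV : (#|S| ^ 2 <= #|V| ^ 2)%N by rewrite leq_exp2r ?max_card.
have := selection_time (leq_trans size_pairs SV).
have : ((c + L) * size (pairs_of S) <= (c + L) * (4 * m))%N.
  by rewrite leq_mul2l (leq_trans size_pairs Sm) orbT.
have : (m <= L * m)%N by rewrite leq_pmull // (leq_trans _ log_lt).
have : (c * m <= c * (L * m))%N.
  by rewrite leq_mul2l leq_pmull ?orbT // (leq_trans _ log_lt).
rewrite -(mulnA (4 * c + 12)%N); lia.
Qed.

(** Outside the descent and the recursive call, a level works on lists of at most [k * #|S|] edges
    or [3 * m] pairs, and [4 * m <= k * #|S|]. *)
Lemma find_best_step fuel (S : {set V}) (a b : R) (k := ceil_div (4 * m) #|S|) :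
  (4 * m < #|S| ^ 2)%N ->
  total (find_knn d tau delta fuel k S) ->
  expected_time R (find_knn d tau delta fuel k S) <= a ->
  (forall S' : {set V}, (4 * #|S'| <= 3 * #|S|)%N ->
     total (find_best d tau delta fuel m S') /\
     expected_time R (find_best d tau delta fuel m S') <= b) ->
  total (find_best d tau delta fuel.+1 m S) /\
  expected_time R (find_best d tau delta fuel.+1 m S) <=
    a + (b + ((4 * c + 12) * L * (k * #|S|))%:R).
Proof.
move=> mS knn_total knn_time IH.
rewrite find_best_recE // -/k.
have recursion G : out_regular S (minn k #|S|.-1) G ->
    total (after_knn fuel S G) /\
    expected_time R (after_knn fuel S G) <=
      b + ((4 * c + 12) * L * (k * #|S|))%:R.
  move=> Gq; rewrite /after_knn.
  have [rec_total rec_time] := IH _ (card_saturated_le d_sym m_gt0 mS Gq).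
  set e := size (edges_of G S).
  have eE : e = (#|S| * minn k #|S|.-1)%N by exact: size_edges_of_regular.
  have S_gt0 : (0 < #|S|)%N by rewrite -(@ltn_exp2r _ _ 2) // (leq_ltn_trans _ mS).
  have kS : (4 * m <= k * #|S|)%N by exact: leq_ceil_div_mul.
  have SV : (#|S| ^ 2 <= #|V| ^ 2)%N by rewrite leq_exp2r ?max_card.
  have ek : (e <= k * #|S|)%N by rewrite eE mulnC leq_mul2r geq_minl orbT.
  have eV : (e <= #|V| ^ 2)%N.
    rewrite (leq_trans _ SV) // eE -mulnn leq_mul2l.
    by rewrite (leq_trans (geq_minr _ _)) ?leq_pred ?orbT.
  have size_sel : (size (selected G S) <= e)%N.
    by rewrite /selected size_take_min size_sort geq_minr.
  have degrees : (\sum_(i in S) #|G i|.+1 = #|S| + e)%N.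
    by rewrite /e size_edges_of -sum1_card -big_split.
  set D := undup [seq upair f | f <- selected G S].
  have size_D : (size D <= 2 * m)%N.
    rewrite (leq_trans (size_undup _)) // size_map /selected size_take_min.
    exact: geq_minl.
  split.
    apply: total_bind => //=.
    exact/(@post_sub _ (fun=> True))/postT.
  have final_time D' : (size D' <= m)%N ->
      expected_time R (Tick (size D + size D') (smallest d tau m (undup (D ++ D'))))
      <= ((3 + 3 * (c + L)) * m)%:R.
    move=> size_D' /=; rewrite addr0 -natrD ler_nat.
    have size_U : (size (undup (D ++ D')) <= 3 * m)%N.
      by rewrite (leq_trans (size_undup _)) // size_cat; lia.
    (* [3 m <= 4 m < #|S|^2], so [L] bounds the logarithm of the merged list too. *)
    have U_V : (size (undup (D ++ D')) <= #|V| ^ 2)%N.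
      rewrite (leq_trans size_U) // (leq_trans _ SV) // ltnW //.
      by rewrite (leq_ltn_trans _ mS) // leq_mul2r orbT.
    have := leq_trans (selection_time U_V) (leq_mul (leqnn _) size_U).
    by move=> /(leq_add (leq_add size_D size_D')) /leq_trans; apply; lia.
  have : expected_time R (D' <-- find_best d tau delta fuel m (saturated d m G S) ;;
      Tick (size D + size D') (smallest d tau m (undup (D ++ D'))))
      <= b + ((3 + 3 * (c + L)) * m)%:R.
    apply: expected_time_bind_le => //.
    by apply: post_sub (post_find_best _ _) => D'; apply: final_time.
  rewrite /=; set t := expected_time _ _ => tb.
  rewrite !addrA -!natrD addrC; apply: le_trans (lerD tb (lexx _)) _.
  rewrite -addrA lerD2l -natrD ler_nat degrees -/e.
  have := selection_time eV; rewrite -/e.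
  move=> xe.
  have : ((c + L) * e <= (c + L) * (k * #|S|))%N by rewrite leq_mul2l ek orbT.
  have : (4 * (c + L) * m <= (c + L) * (k * #|S|))%N.
    by rewrite (mulnC 4%N) -mulnA leq_mul2l kS orbT.
  have k_gt0 : (0 < k)%N by case: (k) kS => //; lia.
  have : (#|S| <= k * #|S|)%N by rewrite leq_pmull.
  have L_gt0 : (0 < L)%N by exact: leq_trans log_lt.
  have : (c * (k * #|S|) <= c * (L * (k * #|S|)))%N.
    by rewrite leq_mul2l leq_pmull ?orbT.
  have : (k * #|S| <= L * (k * #|S|))%N by rewrite leq_pmull.
  rewrite -(mulnA (4 * c + 12)%N); move: xe size_sel ek kS.
  move: (k * #|S|)%N (size (selected G S)) => y z; lia.
have knn_post := @post_find_knn R V d tau delta fuel k S.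
split.
  apply: total_bind knn_total _.
  by apply: post_sub knn_post => G /recursion[].
apply: expected_time_bind_le knn_total knn_time _.
by apply: post_sub knn_post => G /recursion[].
Qed.

(** [W] bounds the descent and the overhead of a level together, so [potential_step] telescopes. The
    node set shrinks at each recursive call, so [#|S|.+1] levels suffice, and every descent keeps at
    least fuel [F]. *)
Lemma find_best_time F (W : R) (S : {set V}) :
  ((4 * c + 12) * L)%:R <= W ->
  (forall k (U : {set V}), (0 < k <= #|V|)%N -> (1 < #|U|)%N ->
     total (find_knn d tau delta F k U) /\
     expected_time R (find_knn d tau delta F k U) +
       ((4 * c + 12) * L * (k * #|U|))%:R <= W * (k%:R ^+ 2 * #|U|%:R)) ->
  total (find_best d tau delta (F + #|S|.+1) m S) /\
  expected_time R (find_best d tau delta (F + #|S|.+1) m S) <=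
    W * potential R m #|S|.
Proof.
move=> W_ge knn_F.
have W0 : 0 <= W by exact: le_trans W_ge.
suff IH n (T : {set V}) : (#|T| <= n)%N ->
    total (find_best d tau delta (F + n.+1) m T) /\
    expected_time R (find_best d tau delta (F + n.+1) m T) <=
      W * potential R m #|T| by exact: IH.
elim: n T => [|n IH] T Tn; have [Tm|mT] := leqP (#|T| ^ 2) (4 * m).
- have [? base_time] := find_best_base_time F Tm; rewrite addn1; split=> //.
  by apply: le_trans base_time _; rewrite natrM ler_pM // natr_le_potential.
- by move: mT; rewrite leqn0 in Tn; rewrite (eqP Tn).
- have [? base_time] := find_best_base_time (F + n.+1) Tm; rewrite addnS; split=> //.
  by apply: le_trans base_time _; rewrite natrM ler_pM // natr_le_potential.
rewrite addnS.
set k := ceil_div (4 * m) #|T|.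
have T_gt1 : (1 < #|T|)%N.
  rewrite -(@ltn_exp2r _ _ 2) // (leq_ltn_trans _ mT) //.
  by rewrite -[X in (X <= _)%N]muln1 leq_mul.
have T_gt0 := ltnW T_gt1.
have kT : (4 * m <= k * #|T|)%N by exact: leq_ceil_div_mul.
have Tk : (k * #|T| <= 4 * m + #|T|)%N by exact: ceil_div_mul_leq.
have k_gt0 : (0 < k)%N by case: (k) kT => //; lia.
(* [k #|T| <= 4 m + #|T| < (#|T| + 1) #|T|] gives [k <= #|T|], within the finite range of degrees
   served by [F]. *)
have kV : (k <= #|V|)%N.
  apply: (@leq_trans #|T|); last exact: max_card.
  rewrite -ltnS -(ltn_pmul2r T_gt0).
  by apply: leq_ltn_trans Tk _; rewrite mulSn; move: mT; rewrite -mulnn; lia.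
have [knn_total knn_time] := knn_F k T (introT andP (conj k_gt0 kV)) T_gt1.
(* The recursive call is allotted what the potential leaves once this level is paid. *)
have [|||? time] := @find_best_step (F + n.+1) T
    (expected_time R (find_knn d tau delta F k T))
    (W * (potential R m #|T| - k%:R ^+ 2 * #|T|%:R)) mT.
- by have [] := find_knn_fuel_mono (leq_addr n.+1 F) knn_total.
- by have [_ ->] := find_knn_fuel_mono (leq_addr n.+1 F) knn_total.
- move=> S' S'T; have [|? S'_time] := IH S'; first by lia.
  split=> //; apply: le_trans S'_time _.
  by rewrite ler_wpM2l // lerBrDr potential_step.
- split=> //; apply: le_trans time _; rewrite mulrBr.
  by rewrite -/k; lra.
Qed.

End FindBestTime.

(** * Logarithms, common fuel and the final bound *)

(** If [2^t <= n^2] then [t ln 2 <= 2 ln n]; the successor costs one more [ln 2 <= ln n], hence the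
    3. *)
Lemma natr_trunc_log_le (R : realType) n : (1 < n)%N ->
  (trunc_log 2 (n ^ 2)).+1%:R <= 3 / ln 2 * ln n%:R :> R.
Proof.
move=> n1; have n0 : 0 < n%:R :> R by rewrite ltr0n ltnW.
have ln2 : 0 < ln 2 :> R by rewrite ln_gt0 // ltr1n.
rewrite mulrAC ler_pdivlMr // -natr1 mulrDl mul1r.
have ln2n : ln 2 <= ln n%:R :> R by rewrite ler_ln ?posrE // ler_nat.
have : (trunc_log 2 (n ^ 2))%:R * ln 2 <= 2 * ln n%:R :> R.
  rewrite !mulr_natl -!lnXn // -!natrX ler_ln ?posrE ?ltr0n ?expn_gt0 ?(ltnW n1) //.
  by rewrite ler_nat trunc_logP // expn_gt0 ltnW.
lra.
Qed.

(* [find_best] runs all its calls of [find_knn] on a common fuel, whereas the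
   hypothesis of the theorem yields one fuel per node set and degree. *)
Lemma uniform_knn_fuel (R : realType) (V : finType) (d : V -> V -> R)
    (tau : V -> V -> nat) (delta : R) (B : nat -> {set V} -> R) (K : nat) :
  (forall k (U : {set V}), (0 < k)%N -> (1 < #|U|)%N ->
     completes_within (fun fuel => find_knn d tau delta fuel k U) (B k U)) ->
  exists F, forall k (U : {set V}), (0 < k <= K)%N -> (1 < #|U|)%N ->
    total (find_knn d tau delta F k U) /\
    expected_time R (find_knn d tau delta F k U) <= B k U.
Proof.
move=> knn.
have /boolp.choice[f fP] : forall p : 'I_K.+1 * {set V}, exists fuel,
    (0 < p.1)%N -> (1 < #|p.2|)%N ->
    total (find_knn d tau delta fuel p.1 p.2) /\
    expected_time R (find_knn d tau delta fuel p.1 p.2) <= B p.1 p.2.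
  move=> [k U] /=.
  have [k0|] := boolP ((0 < k)%N && (1 < #|U|)%N); last first.
    by move=> kU; exists 0%N => k0 U1; rewrite k0 U1 in kU.
  by have /andP[k1 U1] := k0; have [fuel ?] := knn k U k1 U1; exists fuel.
(* There are finitely many pairs of a degree up to [K] and a node set, so the fuels have a
   maximum. *)
exists (\max_p f p)%N => k U /andP[k0 kK] U1.
have kK1 : (k < K.+1)%N by [].
have [t b] := fP (Ordinal kK1, U) k0 U1.
by have [? ->] := find_knn_fuel_mono (leq_bigmax (Ordinal kK1, U)) t.
Qed.

Theorem theorem1 (R : realType) (A : R) (c : nat) :
  exists C : R, forall kappa0 : R, 0 < kappa0 ->
  exists N0 : nat,
  forall (V : finType) (d : V -> V -> R) (tau : V -> V -> nat)
         (delta kappa : R) (m : nat),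
    (N0 <= #|V|)%N ->
    (forall x y : V, x != y -> d x y = d y x) ->
    (forall x y : V, (tau x y <= c)%N) ->
    kappa0 <= kappa ->
    m%:R = kappa * #|V|%:R ->
    (forall (k : nat) (U : {set V}), (0 < k)%N -> (1 < #|U|)%N ->
       completes_within (fun fuel => find_knn d tau delta fuel k U)
         (A * k%:R ^+ 2 * #|U|%:R * ln #|U|%:R)) ->
    completes_within (fun fuel => find_best d tau delta fuel m [set: V])
      (C * kappa `^ (3 / 2) * #|V|%:R `^ (3 / 2) * ln #|V|%:R).
Proof.
(* The two terms pay for the descent, with [A] of arbitrary sign, and for the overhead. The factor
   89 is 81 + 8, from [potential_le] and [N <= s^3] with [s] the root of [m]. *)
pose C1 : R := `|A| + (4 * c + 12)%:R * (3 / ln 2).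
exists (89 * C1) => kappa0 kappa0_gt0.
(* The 2 makes [ln N] positive; the other bound gives [kappa0^-3 <= N]. *)
exists (maxn 2 (Num.bound (kappa0 ^- 3))) => V d tau delta kappa m.
rewrite geq_max => /andP[V_gt1 V_ge] d_sym tau_le kappa_ge mE knn.
set N := #|V| in V_gt1 V_ge mE *.
have N_gt0 : 0 < N%:R :> R by rewrite ltr0n ltnW.
have kappa_gt0 : 0 < kappa by exact: lt_le_trans kappa_ge.
have m_gt0 : (0 < m)%N by rewrite -(ltr0n R) mE mulr_gt0.
have ln2 : 0 < ln 2 :> R by rewrite ln_gt0 // ltr1n.
have lnN : 0 < ln N%:R :> R by rewrite ln_gt0 // ltr1n.
have C1_ge0 : 0 <= C1 by rewrite addr_ge0 // mulr_ge0 // divr_ge0 // ltW.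
pose L := (trunc_log 2 (N ^ 2)).+1.
have W_ge : (4 * c + 12)%:R * L%:R <= (4 * c + 12)%:R * (3 / ln 2) * ln N%:R :> R.
  by rewrite -mulrA ler_wpM2l // natr_trunc_log_le.
have [F knn_F] := uniform_knn_fuel N knn.
have [||S_total S_time] := @find_best_time R V d tau delta c L m d_sym tau_le
    (leqnn L) m_gt0 F (C1 * ln N%:R) [set: V].
- by rewrite natrM (le_trans W_ge) // ler_wpM2r ?(ltW lnN) // /C1 lerDr.
- move=> k U kN U1; have [? time] := knn_F k U kN U1; split=> //.
  have kU1 : 1 <= (k * #|U|)%:R :> R.
    by rewrite ler1n muln_gt0 (ltnW U1) andbT; case/andP: kN.
  have kU : (k * #|U|)%:R <= k%:R ^+ 2 * #|U|%:R :> R.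
    rewrite -natrX -natrM ler_nat leq_mul2r -mulnn leq_pmull ?orbT //.
    by case/andP: kN.
  have lnU : ln #|U|%:R <= ln N%:R :> R.
    by rewrite ler_ln ?posrE ?ltr0n ?(ltnW U1) ?(ltnW V_gt1) // ler_nat max_card.
  have lnU0 : 0 <= ln #|U|%:R :> R by rewrite ln_ge0 // ler1n ltnW.
  have knn_le : expected_time R (find_knn d tau delta F k U) <=
      `|A| * (k%:R ^+ 2 * #|U|%:R) * ln N%:R.
    apply: le_trans time _; rewrite -[A * _ * _]mulrA.
    have X0 : 0 <= k%:R ^+ 2 * #|U|%:R :> R by rewrite mulr_ge0 ?exprn_ge0.
    apply: le_trans (ler_wpM2r lnU0 (ler_wpM2r X0 (ler_norm A))) _.
    by rewrite ler_wpM2l // mulr_ge0.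
  have rest_le : ((4 * c + 12) * L * (k * #|U|))%:R <=
      (4 * c + 12)%:R * (3 / ln 2) * ln N%:R * (k%:R ^+ 2 * #|U|%:R) :> R.
    by rewrite natrM (natrM R (4 * c + 12)) ler_pM // mulr_ge0.
  apply: le_trans (lerD knn_le rest_le) _.
  by rewrite /C1 !mulrDl mulrAC.
exists (F + #|[set: V]|.+1)%N; split=> //; apply: le_trans S_time _.
rewrite cardsT -/N.
have root_m : Num.sqrt m%:R ^+ 3 = kappa `^ (3 / 2) * N%:R `^ (3 / 2).
  rewrite -powRM ?ltW // -mE mulrC powRrM powR_mulrn ?powR_ge0 //.
  by rewrite powR12_sqrt.
(* Squared, this is [N^2 <= kappa^3 N^3], which follows from [1 <= kappa0^3 N]. *)
have N_le : N%:R <= Num.sqrt m%:R ^+ 3 :> R.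
  rewrite -(@ler_pXn2r _ 2) ?nnegrE ?exprn_ge0 ?sqrtr_ge0 //.
  rewrite exprAC sqr_sqrtr // mE exprMn.
  have -> : N%:R ^+ 3 = N%:R * N%:R ^+ 2 :> R by ring.
  rewrite mulrA ler_peMl ?exprn_ge0 //.
  have k3 : 0 < kappa0 ^+ 3 by rewrite exprn_gt0.
  have : kappa0 ^- 3 <= N%:R.
    by rewrite (le_trans (ltW (archi_boundP _))) ?ler_nat // invr_ge0 ltW.
  rewrite -div1r ler_pdivrMr // => /le_trans; apply.
  rewrite mulrC ler_wpM2r // lerXn2r ?nnegrE ?(ltW kappa0_gt0) ?(ltW kappa_gt0) //.
have -> : 89 * C1 * kappa `^ (3 / 2) * N%:R `^ (3 / 2) * ln N%:R =
    C1 * ln N%:R * (89 * (kappa `^ (3 / 2) * N%:R `^ (3 / 2))) by ring.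
rewrite -root_m ler_wpM2l ?mulr_ge0 ?(ltW lnN) //.
by apply: le_trans (potential_le _ _ _) _; lra.
Qed.
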